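(* Let $\{(x^k,y^k,z^k)\}$ be generated by the inexact augmented Lagrangian method (see context) applied to $\min_{x\in X}f_0(x)$ s.t. $Ax=b$, $f_i(x)\le0$, $i=1,\dots,m$, with $y^0=0$, $z^0=0$ and $0<\rho_k\le\beta_k$ for all $k$. Let $(x^*,y^*,z^* )$ be a KKT point. Then for every integer $K\ge1$, $$\big|f_0(\bar x^{K})-f_0(x^* )\big|\le\frac{1}{\sum_{t=0}^{K-1}\rho_t}\left(2\|y^*\|^2+2\|z^*\|^2+\sum_{k=0}^{K-1}\rho_k\varepsilon_k\right),$$ $$\|A\bar x^{K}-b\|+\big\|[f(\bar x^{K})]_+\big\|\le\frac{1}{\sum_{t=0}^{K-1}\rho_t}\left(\frac{(1+\|y^*\|)^2}{2}+\frac{(1+\|z^*\|)^2}{2}+\sum_{k=0}^{K-1}\rho_k\varepsilon_k\right),$$ where $\bar x^{K}=\frac{\sum_{t=0}^{K-1}\rho_t x^{t+1}}{\sum_{t=0}^{K-1}\rho_t}$.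
   Context: Setting: $X\subseteq\mathbb R^n$ is closed and convex, $A$ a matrix, $b$ a vector, $f_0:\mathbb R^n\to\mathbb R\cup\{+\infty\}$ proper convex, $f_1,\dots,f_m$ convex and differentiable, $f(x)=(f_1(x),\dots,f_m(x))$, $[\cdot]_+$ is the componentwise positive part and $\|\cdot\|$ the Euclidean norm. KKT point $(x^*,y^*,z^* )$ (assumed to exist): $0\in\partial f_0(x^* )+N_X(x^* )+A^\top y^*+\sum_{i=1}^m z_i^*\nabla f_i(x^* )$ ($N_X$ the normal cone of $X$), $Ax^*=b$, $x^*\in X$, and $z_i^*\ge0$, $f_i(x^* )\le0$, $z_i^*f_i(x^* )=0$ for all $i$. Augmented Lagrangian: $\mathcal L_\beta(x,y,z)=f_0(x)+y^\top(Ax-b)+\frac\beta2\|Ax-b\|^2+\sum_{i=1}^m\psi_\beta(f_i(x),z_i)$, where $\psi_\beta(u,v)=uv+\frac\beta2u^2$ if $\beta u+v\ge0$ and $\psi_\beta(u,v)=-\frac{v^2}{2\beta}$ if $\beta u+v<0$. Inexact augmented Lagrangian method with penalty parameters $\beta_k>0$, step sizes $\rho_k>0$ and tolerances $\varepsilon_k\ge0$: for $k=0,1,\dots$, find $x^{k+1}\in X$ with $\mathcal L_{\beta_k}(x^{k+1},y^k,z^k)\le\min_{x\in X}\mathcal L_{\beta_k}(x,y^k,z^k)+\varepsilon_k$ (such a point is assumed to exist for every $k$); then set $y^{k+1}=y^k+\rho_k(Ax^{k+1}-b)$ and $z_i^{k+1}=z_i^k+\rho_k\max\big(-\frac{z_i^k}{\beta_k},f_i(x^{k+1})\big)$,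 $i=1,\dots,m$. *)

(* Defs.v *)
From HB Require Import structures.
From mathcomp Require Import all_boot all_order all_algebra.
From mathcomp Require Import all_classical all_reals all_analysis.
Set Implicit Arguments.
Unset Strict Implicit.
Unset Printing Implicit Defensive.
Import Order.TTheory GRing.Theory Num.Theory.
Import numFieldNormedType.Exports.
Local Open Scope classical_set_scope.
Local Open Scope ring_scope.
Local Open Scope convex_scope.

Definition dot (R : realType) (n : nat) (u v : 'cV[R]_n) : R :=
  \sum_(i < n) u i 0 * v i 0.

(* The library norm `|u| on matrices is the sup norm; this is the Euclidean one. *)
Definition norm2 (R : realType) (n : nat) (u : 'cV[R]_n) : R :=
  Num.sqrt (dot u u).

Definition pos_part (R : realType) (n : nat) (u : 'cV[R]_n) : 'cV[R]_n :=
  \col_i Num.max (u i 0) 0.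

Definition eproper (R : realType) (n : nat) (f : 'cV[R]_n -> \bar R) : Prop :=
  (forall x, -oo < f x)%E /\ exists x, (f x < +oo)%E.

(* Extended-valued counterpart of [convex_function].  It is meant for functions
   that avoid -oo, so the right-hand side is never of the form +oo - oo;
   note that 0 * +oo = 0 in \bar R. *)
Definition econvex (R : realType) (n : nat) (f : 'cV[R]_n -> \bar R) : Prop :=
  forall (t : {i01 R}) (x y : convex_lmodType 'cV[R]_n),
    (f (x <| t |> y) <= (t%:num)%:E * f x + (1 - t%:num)%:E * f y)%E.

Definition subdiff (R : realType) (n : nat) (f : 'cV[R]_n -> \bar R)
    (x : 'cV[R]_n) : set 'cV[R]_n :=
  [set g | forall y, (f x + (dot g (y - x))%:E <= f y)%E].

Definition normal_cone (R : realType) (n : nat) (X : set 'cV[R]_n)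
    (x : 'cV[R]_n) : set 'cV[R]_n :=
  [set v | X x /\ forall y, X y -> dot v (y - x) <= 0].

Definition gradient (R : realType) (n : nat) (f : 'cV[R]_n -> R)
    (x : 'cV[R]_n) : 'cV[R]_n :=
  \col_j 'D_(delta_mx j 0) f x.

Record KKT (R : realType) (n p m : nat) (X : set 'cV[R]_n)
    (f0 : 'cV[R]_n -> \bar R) (A : 'M[R]_(p, n)) (b : 'cV[R]_p)
    (f : 'I_m -> 'cV[R]_n -> R)
    (x : 'cV[R]_n) (y : 'cV[R]_p) (z : 'cV[R]_m) : Prop := {
  KKT_stationary :
    [set u + v + A^T *m y + \sum_i z i 0 *: gradient (f i) x
      | u in subdiff f0 x & v in normal_cone X x] 0;
  KKT_eq : A *m x = b;
  KKT_mem : X x;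
  KKT_dual : forall i, 0 <= z i 0;
  KKT_ineq : forall i, f i x <= 0;
  KKT_compl : forall i, z i 0 * f i x = 0 }.

Definition psi (R : realType) (beta u v : R) : R :=
  if 0 <= beta * u + v then u * v + beta / 2 * u ^+ 2
  else - (v ^+ 2 / (2 * beta)).

Definition aug_lagrangian (R : realType) (n p m : nat)
    (f0 : 'cV[R]_n -> \bar R) (A : 'M[R]_(p, n)) (b : 'cV[R]_p)
    (f : 'I_m -> 'cV[R]_n -> R) (beta : R)
    (x : 'cV[R]_n) (y : 'cV[R]_p) (z : 'cV[R]_m) : \bar R :=
  (f0 x + (dot y (A *m x - b) + beta / 2 * norm2 (A *m x - b) ^+ 2
           + \sum_i psi beta (f i x) (z i 0))%:E)%E.

(* [x 0] is unconstrained: the method never uses it. The minimal value of the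
   subproblem is its infimum over X; it need not be attained. *)
Record inexact_ALM (R : realType) (n p m : nat) (X : set 'cV[R]_n)
    (f0 : 'cV[R]_n -> \bar R) (A : 'M[R]_(p, n)) (b : 'cV[R]_p)
    (f : 'I_m -> 'cV[R]_n -> R) (beta rho eps : nat -> R)
    (x : nat -> 'cV[R]_n) (y : nat -> 'cV[R]_p) (z : nat -> 'cV[R]_m)
    : Prop := {
  ALM_mem : forall k, X (x k.+1);
  ALM_inexact : forall k,
    (aug_lagrangian f0 A b f (beta k) (x k.+1) (y k) (z k)
     <= ereal_inf [set aug_lagrangian f0 A b f (beta k) w (y k) (z k) | w in X]
        + (eps k)%:E)%E;
  ALM_y : forall k, y k.+1 = y k + rho k *: (A *m x k.+1 - b);
  ALM_z : forall k i,
    z k.+1 i 0 =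
      z k i 0 + rho k * Num.max (- (z k i 0 / beta k)) (f i (x k.+1)) }.

Definition wavg (R : realType) (n : nat) (rho : nat -> R)
    (x : nat -> 'cV[R]_n) (K : nat) : 'cV[R]_n :=
  (\sum_(t < K) rho t)^-1 *: \sum_(t < K) rho t *: x t.+1.

(* Main.v *)
(* Since rho_k <= beta_k, each step decreases the squared distance of (y, z) to an
   arbitrary (y', z') with z' >= 0 by at least twice rho_k times the Lagrangian gap
   f0(x^{k+1}) - f0(xs) + <y', A x^{k+1} - b> + <z', f(x^{k+1})>, up to 2 rho_k eps_k.
   Summing and using convexity,
     S (f0(xbar) - f0(xs) + <y', r> + <z', f(xbar)>)
       <= sum_k rho_k eps_k + |y'|^2/2 + |z'|^2/2,
   with S = sum_t rho_t and r = A xbar - b. Put g = [f(xbar)]_+ and take y', z' along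
   r and g with lengths c, c'. The KKT conditions give
   f0(xbar) - f0(xs) >= - |ys| |r| - |zs| |g|, so (c, c') = (1 + |ys|, 1 + |zs|) yields
   the feasibility bound, while (2|ys|, 2|zs|) and (0, 0) yield the lower and upper
   bounds on the objective. *)
Require Import Defs.
From mathcomp Require Import all_boot all_order all_algebra.
From mathcomp Require Import all_classical all_reals all_analysis.
From mathcomp Require Import ring lra.
Set Implicit Arguments.
Unset Strict Implicit.
Unset Printing Implicit Defensive.
Import Order.TTheory GRing.Theory Num.Theory.
Import numFieldNormedType.Exports.
Local Open Scope classical_set_scope.
Local Open Scope ring_scope.

(** * Euclidean inner product and norm *)

Lemma dotE (R : realType) (n : nat) (u v : 'cV[R]_n) :
  dot u v = (u^T *m v) 0 0.
Proof. by rewrite mxE; apply: eq_bigr => i _; rewrite mxE. Qed.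

Lemma dotC (R : realType) (n : nat) (u v : 'cV[R]_n) : dot u v = dot v u.
Proof. by apply: eq_bigr => i _; rewrite mulrC. Qed.

Lemma dotDr (R : realType) (n : nat) (u v w : 'cV[R]_n) :
  dot u (v + w) = dot u v + dot u w.
Proof. by rewrite !dotE mulmxDr mxE. Qed.

Lemma dotZr (R : realType) (n : nat) (a : R) (u v : 'cV[R]_n) :
  dot u (a *: v) = a * dot u v.
Proof. by rewrite !dotE -scalemxAr mxE. Qed.

Lemma dotDl (R : realType) (n : nat) (u v w : 'cV[R]_n) :
  dot (u + v) w = dot u w + dot v w.
Proof. by rewrite ![dot _ w]dotC dotDr. Qed.

Lemma dotZl (R : realType) (n : nat) (a : R) (u v : 'cV[R]_n) :
  dot (a *: u) v = a * dot u v.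
Proof. by rewrite ![dot _ v]dotC dotZr. Qed.

Lemma dot0l (R : realType) (n : nat) (u : 'cV[R]_n) : dot 0 u = 0.
Proof. by rewrite -(scale0r 0) dotZl mul0r. Qed.

Lemma dot0r (R : realType) (n : nat) (u : 'cV[R]_n) : dot u 0 = 0.
Proof. by rewrite dotC dot0l. Qed.

Lemma dotNl (R : realType) (n : nat) (u v : 'cV[R]_n) :
  dot (- u) v = - dot u v.
Proof. by rewrite -scaleN1r dotZl mulN1r. Qed.

Lemma dotNr (R : realType) (n : nat) (u v : 'cV[R]_n) :
  dot u (- v) = - dot u v.
Proof. by rewrite dotC dotNl dotC. Qed.

Lemma dot_suml (R : realType) (n m : nat) (F : 'I_m -> 'cV[R]_n) (w : 'cV[R]_n) :
  dot (\sum_i F i) w = \sum_i dot (F i) w.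
Proof.
elim/big_ind2: _ => [|a u b v <- <-|//]; last by rewrite dotDl.
by rewrite dot0l.
Qed.

Lemma dot_trmx (R : realType) (n p : nat) (A : 'M[R]_(p, n)) (u : 'cV[R]_p)
    (v : 'cV[R]_n) : dot (A^T *m u) v = dot u (A *m v).
Proof. by rewrite !dotE trmx_mul trmxK mulmxA. Qed.

Lemma dot_ge0 (R : realType) (n : nat) (u : 'cV[R]_n) : 0 <= dot u u.
Proof. by apply: sumr_ge0 => i _; rewrite -expr2 sqr_ge0. Qed.

Lemma norm2_ge0 (R : realType) (n : nat) (u : 'cV[R]_n) : 0 <= norm2 u.
Proof. exact: sqrtr_ge0. Qed.

Lemma norm2_sqr (R : realType) (n : nat) (u : 'cV[R]_n) :
  norm2 u ^+ 2 = dot u u.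
Proof. by rewrite sqr_sqrtr ?dot_ge0. Qed.

Lemma norm20 (R : realType) (n : nat) : norm2 (0 : 'cV[R]_n) = 0.
Proof. by apply/eqP; rewrite -sqrf_eq0 norm2_sqr dot0l. Qed.

Lemma norm2_eq0 (R : realType) (n : nat) (u : 'cV[R]_n) :
  norm2 u = 0 -> u = 0.
Proof.
move=> u0; have /eqP : dot u u = 0 by rewrite -norm2_sqr u0 expr0n.
rewrite psumr_eq0 => [/allP h|i _]; last by rewrite -expr2 sqr_ge0.
apply/matrixP => i j; rewrite ord1 mxE; apply/eqP.
by have := h i (mem_index_enum i); rewrite -expr2 sqrf_eq0.
Qed.

(** Cauchy-Schwarz, by expanding the squared length of |v| u - |u| v. The common factor |u| |v| is
    cancelled, so zero vectors are treated first. *)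
Lemma dot_le_norm2 (R : realType) (n : nat) (u v : 'cV[R]_n) :
  dot u v <= norm2 u * norm2 v.
Proof.
have [/norm2_eq0->|u0] := eqVneq (norm2 u) 0.
  by rewrite norm20 mul0r dot0l.
have [/norm2_eq0->|v0] := eqVneq (norm2 v) 0.
  by rewrite norm20 mulr0 dot0r.
have uv_gt0 : 0 < norm2 u * norm2 v.
  by rewrite mulr_gt0 // lt_def ?u0 ?v0 norm2_ge0.
have := dot_ge0 (norm2 v *: u - norm2 u *: v).
rewrite dotDl !dotDr !dotNl !dotNr !dotZl !dotZr -!norm2_sqr (dotC v u) => h.
rewrite -(ler_pM2l uv_gt0); lra.
Qed.

(* [c / norm2 u] is 0 when u = 0. *)
Lemma norm2_dual (R : realType) (n : nat) (c : R) (u : 'cV[R]_n) : 0 <= c ->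
  let v := (c / norm2 u) *: u in
  dot v u = c * norm2 u /\ norm2 v ^+ 2 <= c ^+ 2.
Proof.
move=> c0 /=; rewrite norm2_sqr !dotZl dotZr -norm2_sqr.
have [->|u0] := eqVneq (norm2 u) 0.
  by rewrite expr0n /= !mulr0; split=> //; apply: sqr_ge0.
split; first by field.
by rewrite le_eqVlt; apply/orP; left; apply/eqP; field.
Qed.

(** * The penalty function [psi] *)

Lemma psi_le0 (R : realType) (beta u v : R) :
  0 < beta -> u <= 0 -> psi beta u v <= 0.
Proof.
move=> b0 u0; rewrite /psi; case: ifP => [h|_].
  suff : 0 <= - u * (v + beta / 2 * u) by lra.
  apply: mulr_ge0; first lra.
  suff : beta * u <= 0 by lra.
  by rewrite pmulr_rle0.
by rewrite oppr_le0 divr_ge0 ?sqr_ge0 //; lra.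
Qed.

(** With d = max(-v/beta, u), both branches of [psi] equal v d + beta/2 d^2. After division by rho
    the gap is therefore w (d - u) + (beta - rho)/2 d^2, and both terms are nonnegative. *)
Lemma psi_ge (R : realType) (beta rho u v w : R) :
  0 < rho -> rho <= beta -> 0 <= w ->
  rho * (w * u) + ((v + rho * Num.max (- (v / beta)) u - w) ^+ 2
                    - (v - w) ^+ 2) / 2 <= rho * psi beta u v.
Proof.
move=> r0 rb w0; have b0 : 0 < beta by lra.
set d := Num.max _ _.
have -> : rho * (w * u) + ((v + rho * d - w) ^+ 2 - (v - w) ^+ 2) / 2
        = rho * (w * u + (v - w) * d + rho / 2 * d ^+ 2) by field.
rewrite ler_pM2l // /d /psi {d}.
have -> : (0 <= beta * u + v) = (- (v / beta) <= u).
  by rewrite -mulNr ler_pdivrMr //; apply/idP/idP; lra.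
case: (leP (- (v / beta)) u) => h.
  suff : 0 <= (beta - rho) * u ^+ 2 by lra.
  by rewrite mulr_ge0 ?sqr_ge0 //; lra.
rewrite /= in h *; set t := v / beta in h *.
have -> : - (v ^+ 2 / (2 * beta)) = - (beta / 2 * t ^+ 2).
  by rewrite /t; field; rewrite gt_eqF.
have -> : v = t * beta by rewrite /t divfK // gt_eqF.
suff : 0 <= w * (- t - u) + (beta - rho) / 2 * t ^+ 2 by lra.
by apply: addr_ge0; apply: mulr_ge0; rewrite ?sqr_ge0 //; lra.
Qed.

(** * Weighted averages *)

Lemma sum_ord_gt0 (R : realType) (rho : nat -> R) (K : nat) :
  (forall k, 0 < rho k) -> (1 <= K)%N -> 0 < \sum_(t < K) rho t.
Proof.
move=> rho0; case: K => // K _; rewrite big_ord_recr /=.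
by rewrite ltr_wpDl // sumr_ge0 // => i _; apply: ltW.
Qed.

(* Stated for a binary predicate so that convex sets and epigraphs (Jensen's
   inequality) are instances. *)
Lemma wavg_conv (R : realType) (n : nat) (P : 'cV[R]_n -> R -> Prop)
    (rho a : nat -> R) (x : nat -> 'cV[R]_n) :
  (forall (t : {i01 R}) v w r s, P v r -> P w s ->
     P (t%:num *: v + (1 - t%:num) *: w) (t%:num * r + (1 - t%:num) * s)) ->
  (forall k, 0 < rho k) -> (forall k, P (x k.+1) (a k)) ->
  forall K, (1 <= K)%N ->
  P (wavg rho x K) ((\sum_(t < K) rho t)^-1 * \sum_(t < K) rho t * a t).
Proof.
move=> Pconv rho0 Px; case=> // K _; elim: K => [|K IH].
  rewrite /wavg !big_ord1 scalerA mulrA mulVf ?gt_eqF // scale1r mul1r.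
  exact: Px.
set S := \sum_(t < K.+1) rho t.
have S0 : 0 < S by exact: sum_ord_gt0.
have r0 := rho0 K.+1.
have T0 : S + rho K.+1 != 0 by rewrite gt_eqF // addr_gt0.
(* The new average is a convex combination of the old one, with weight S / (S + rho_{K+1}), and the
   added point. *)
have t0 : 0 <= S / (S + rho K.+1) by rewrite divr_ge0 ?addr_ge0 // ltW.
have t1 : S / (S + rho K.+1) <= 1.
  by rewrite ler_pdivrMr ?addr_gt0 // mul1r lerDl ltW.
have := Pconv (Itv01 t0 t1) _ _ _ _ IH (Px K.+1).
rewrite /wavg /= !(big_ord_recr K.+1) /= -/S.
have E : 1 - S / (S + rho K.+1) = (S + rho K.+1)^-1 * rho K.+1 by field.
rewrite E scalerDr !scalerA mulrDr !mulrA.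
have -> : S / (S + rho K.+1) * S^-1 = (S + rho K.+1)^-1.
  by rewrite mulrAC divff ?mul1r // gt_eqF.
by [].
Qed.

(** * First-order convexity and the KKT conditions *)

Lemma gradient_dot (R : realType) (n : nat) (f : 'cV[R]_n -> R)
    (x v : 'cV[R]_n) : differentiable f x -> dot (gradient f x) v = 'D_v f x.
Proof.
move=> df; rewrite deriveE // {2}[v]matrix_sum_delta linear_sum.
apply: eq_bigr => i _; rewrite big_ord1 linearZ mxE deriveE // mulrC.
by congr (_ * _).
Qed.

(** For 0 < h <= 1 convexity bounds the difference quotient along y - x by f y - f x; let h tend to
    0 from the right. *)
Lemma convex_gradient_le (R : realType) (n : nat) (f : 'cV[R]_n -> R)
    (x y : 'cV[R]_n) : convex_function setT f -> differentiable f x ->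
  f x + dot (gradient f x) (y - x) <= f y.
Proof.
move=> cf df; rewrite gradient_dot // addrC -lerBrDr.
have h := cvg_dnbhs_at_right (diff_derivable (v := y - x) df).
apply: cvgr_to_le h _.
near=> h.
have h0 : 0 < h by [].
have h1 : h <= 1 by near: h; exact: nbhs_right_le.
have H : f (h *: y + (1 - h) *: x) <= h * f y + (1 - h) * f x.
  exact: (cf (Itv01 (ltW h0) h1) y x (in_setT _) (in_setT _)).
rewrite /= -[_ *: _]/(_ * _) ler_pdivrMl //.
have -> : h *: (y - x) + x = h *: y + (1 - h) *: x.
  by rewrite scalerBr scalerBl scale1r -!addrA [- _ + x]addrC.
move: H; lra.
Unshelve. all: by end_near. Qed.

Lemma subdiff_fin_num (R : realType) (n : nat) (f : 'cV[R]_n -> \bar R)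
    (x u : 'cV[R]_n) : eproper f -> subdiff f x u -> f x \is a fin_num.
Proof.
move=> [fgt [w fw]] /(_ w) uw; rewrite fin_numElt fgt /=.
by case: (f x) uw (fgt x) => // /(le_lt_trans) /(_ fw).
Qed.

(** Pair the stationarity equation with v - xs: the normal cone term is nonpositive, and the
    gradient terms are bounded by first-order convexity, where complementarity cancels z_i
    f_i(xs). *)
Lemma KKT_saddle (R : realType) (n p m : nat) (X : set 'cV[R]_n)
    (f0 : 'cV[R]_n -> \bar R) (A : 'M[R]_(p, n)) (b : 'cV[R]_p)
    (f : 'I_m -> 'cV[R]_n -> R) (xs : 'cV[R]_n) (ys : 'cV[R]_p)
    (zs : 'cV[R]_m) (v : 'cV[R]_n) :
  (forall i, convex_function setT (f i)) ->
  (forall i x, differentiable (f i) x) ->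
  KKT X f0 A b f xs ys zs -> X v ->
  (f0 xs <= f0 v + (dot ys (A *m v - b) + \sum_i zs i 0 * f i v)%:E)%E.
Proof.
move=> cf df [[g gsub] [h [_ hcone] stat] Axs _ zs0 _ compl] Xv.
have hv := hcone _ Xv.
rewrite -leeBlDr // -EFinN; apply: le_trans (gsub v).
apply: leeD2l; rewrite lee_fin.
have : dot (g + h + A^T *m ys + \sum_i zs i 0 *: gradient (f i) xs) (v - xs) = 0.
  by rewrite stat dot0l.
rewrite !dotDl dot_trmx mulmxBr Axs dot_suml => E.
suff : \sum_i dot (zs i 0 *: gradient (f i) xs) (v - xs)
       <= \sum_i zs i 0 * f i v by lra.
apply: ler_sum => i _; rewrite dotZl.
have := ler_wpM2l (zs0 i) (convex_gradient_le v (cf i) (df i xs)).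
by rewrite mulrDr compl add0r.
Qed.

(** * Dual distances along the method *)

Lemma norm2_step (R : realType) (n : nat) (rho : R) (u r w : 'cV[R]_n) :
  norm2 (u + rho *: r - w) ^+ 2
  = norm2 (u - w) ^+ 2 + 2 * rho * (dot u r - dot w r) + rho ^+ 2 * norm2 r ^+ 2.
Proof.
rewrite !norm2_sqr !(dotDl, dotDr, dotNl, dotNr, dotZl, dotZr).
rewrite (dotC r u) (dotC w u) (dotC r w); ring.
Qed.

(* The augmented Lagrangian step is a proximal point step on the dual, which is
   why the squared distances to an arbitrary dual pair (y', z') telescope. *)
Lemma ALM_step (R : realType) (n p m : nat) (X : set 'cV[R]_n)
    (A : 'M[R]_(p, n)) (b : 'cV[R]_p)
    (f0 : 'cV[R]_n -> \bar R) (f : 'I_m -> 'cV[R]_n -> R)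
    (beta rho eps : nat -> R)
    (x : nat -> 'cV[R]_n) (y : nat -> 'cV[R]_p) (z : nat -> 'cV[R]_m)
    (w : 'cV[R]_n) (y' : 'cV[R]_p) (z' : 'cV[R]_m) (k : nat) :
  eproper f0 -> 0 < rho k -> rho k <= beta k ->
  inexact_ALM X f0 A b f beta rho eps x y z ->
  X w -> A *m w = b -> (forall i, f i w <= 0) -> f0 w \is a fin_num ->
  (forall i, 0 <= z' i 0) ->
  f0 (x k.+1) \is a fin_num /\
  rho k * (fine (f0 (x k.+1)) - fine (f0 w) + dot y' (A *m x k.+1 - b)
           + \sum_i z' i 0 * f i (x k.+1))
  <= rho k * eps k + (norm2 (y k - y') ^+ 2 - norm2 (y k.+1 - y') ^+ 2) / 2
     + (norm2 (z k - z') ^+ 2 - norm2 (z k.+1 - z') ^+ 2) / 2.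
Proof.
move=> [fgt _] r0 rb [Xx inex yE zE] Xw Aw fw f0w z'0.
have b0 : 0 < beta k by lra.
have le1 : (aug_lagrangian f0 A b f (beta k) (x k.+1) (y k) (z k)
            <= f0 w + (eps k)%:E)%E.
  (* Compare the infimum with the feasible point w: the equality terms vanish there and each [psi]
     term is nonpositive. *)
  apply: le_trans (inex k) _; apply: leeD2r; apply: ereal_inf_le.
  exists (aug_lagrangian f0 A b f (beta k) w (y k) (z k)); first by exists w.
  rewrite /aug_lagrangian Aw subrr dot0r norm20.
  rewrite expr0n /= mulr0 !add0r -[leRHS]adde0; apply: leeD2l.
  by rewrite lee_fin sumr_le0 // => i _; apply: psi_le0.
have fx : f0 (x k.+1) \is a fin_num.
  rewrite fin_numElt fgt /=; move: le1; rewrite /aug_lagrangian -(fineK f0w).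
  by case: (f0 (x k.+1)) (fgt (x k.+1)) => //= r _ _; rewrite ltry.
split=> //; move: le1; rewrite /aug_lagrangian -(fineK f0w) -(fineK fx).
rewrite -!EFinD lee_fin /= => le1.
have zle : \sum_i rho k * (z' i 0 * f i (x k.+1))
    + (norm2 (z k.+1 - z') ^+ 2 - norm2 (z k - z') ^+ 2) / 2
    <= \sum_i rho k * psi (beta k) (f i (x k.+1)) (z k i 0).
  rewrite !norm2_sqr /dot -sumrB mulr_suml -big_split /=.
  apply: ler_sum => i _; rewrite !mxE zE -!expr2.
  exact: psi_ge.
have := norm2_step (rho k) (y k) (A *m x k.+1 - b) y'.
rewrite -yE => yE'.
have := ler_wpM2l (ltW r0) le1.
move: zle; rewrite -!mulr_sumr => zle.
(* The quadratic penalty supplies rho beta/2 |r|^2, while expanding |y_{k+1} - y'|^2 costs only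
   rho^2/2 |r|^2; this is twice the surplus. *)
have : 0 <= rho k * (beta k - rho k) * norm2 (A *m x k.+1 - b) ^+ 2.
  by rewrite mulr_ge0 ?sqr_ge0 // mulr_ge0 ?subr_ge0 ?rb // ltW.
move: zle yE'; lra.
Qed.

Lemma ALM_ergodic (R : realType) (n p m : nat) (X : set 'cV[R]_n)
    (A : 'M[R]_(p, n)) (b : 'cV[R]_p)
    (f0 : 'cV[R]_n -> \bar R) (f : 'I_m -> 'cV[R]_n -> R)
    (beta rho eps : nat -> R)
    (x : nat -> 'cV[R]_n) (y : nat -> 'cV[R]_p) (z : nat -> 'cV[R]_m)
    (w : 'cV[R]_n) (y' : 'cV[R]_p) (z' : 'cV[R]_m) (K : nat) :
  convex_set X -> eproper f0 -> econvex f0 ->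
  (forall i, convex_function setT (f i)) ->
  (forall k, 0 < rho k) -> (forall k, rho k <= beta k) ->
  inexact_ALM X f0 A b f beta rho eps x y z -> y 0%N = 0 -> z 0%N = 0 ->
  X w -> A *m w = b -> (forall i, f i w <= 0) -> f0 w \is a fin_num ->
  (forall i, 0 <= z' i 0) -> (1 <= K)%N ->
  let xbar := wavg rho x K in
  [/\ X xbar, f0 xbar \is a fin_num &
    (\sum_(t < K) rho t) * (fine (f0 xbar) - fine (f0 w)
       + dot y' (A *m xbar - b) + \sum_i z' i 0 * f i xbar)
    <= \sum_(k < K) rho k * eps k + norm2 y' ^+ 2 / 2 + norm2 z' ^+ 2 / 2].
Proof.
move=> Xconv f0p f0conv fconv r0 rb alm y0 z0 Xw Aw fw f0w z'0 K1 xbar.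
have step k := ALM_step y' f0p (r0 k) (rb k) alm Xw Aw fw f0w z'0.
pose L v := fine (f0 v) + dot y' (A *m v - b) + \sum_i z' i 0 * f i v.
(* The epigraph of the convex function [L] over X. Finiteness is part of the predicate because
   [fine] sends infinite values to 0. *)
pose P v r := [/\ X v, f0 v \is a fin_num & L v <= r].
have Pconv (t : {i01 R}) v v' r s : P v r -> P v' s ->
    P (t%:num *: v + (1 - t%:num) *: v') (t%:num * r + (1 - t%:num) * s).
  move=> [Xv fv Lv] [Xv' fv' Lv'].
  set c := _ + _.
  have t0 : 0 <= t%:num :> R by [].
  have t1 : 0 <= 1 - t%:num :> R by rewrite subr_ge0.
  have fc : (f0 c <= (t%:num * fine (f0 v) + (1 - t%:num) * fine (f0 v'))%:E)%E.
    rewrite EFinD !EFinM !fineK //; exact: f0conv.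
  have fc_fin : f0 c \is a fin_num.
    by rewrite fin_numElt f0p.1 /= (le_lt_trans fc) // ltry.
  split=> //.
    by apply/set_mem; apply: (Xconv v v' t); apply/mem_set.
  apply: (@le_trans _ _ (t%:num * L v + (1 - t%:num) * L v')).
    move: fc; rewrite -(fineK fc_fin) lee_fin => fc; rewrite /L.
    have -> : A *m c - b
        = t%:num *: (A *m v - b) + (1 - t%:num) *: (A *m v' - b).
      rewrite mulmxDr -!scalemxAr !scalerBr -[in LHS](scale1r b).
      rewrite addrACA -opprD -scalerDl; congr (_ - _ *: _); ring.
    have fic : \sum_i z' i 0 * f i c
        <= t%:num * (\sum_i z' i 0 * f i v)
           + (1 - t%:num) * (\sum_i z' i 0 * f i v').
      rewrite !mulr_sumr -big_split /=; apply: ler_sum => i _.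
      have := ler_wpM2l (z'0 i) (fconv i t v v' (in_setT _) (in_setT _)).
      by rewrite mulrDr !(mulrCA (z' i 0)).
    rewrite dotDr !dotZr; lra.
  by apply: lerD; apply: ler_wpM2l.
have Px k : P (x k.+1) (L (x k.+1)).
  by split; [exact: (ALM_mem alm) | exact: (step k).1 | ].
have [Xb fb Lb] := wavg_conv Pconv r0 Px K1.
split=> //.
have S0 := sum_ord_gt0 r0 K1.
move: Lb; rewrite ler_pdivlMl // => Lb.
suff : \sum_(t < K) rho t * (L (x t.+1) - fine (f0 w))
       <= \sum_(k < K) rho k * eps k + norm2 y' ^+ 2 / 2 + norm2 z' ^+ 2 / 2.
  under eq_bigr do rewrite mulrBr.
  by rewrite sumrB -mulr_suml; move: Lb; rewrite /L; lra.
(* The squared distances telescope; the final ones are then dropped, and the zero start leaves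
   |y'|^2/2 and |z'|^2/2. *)
have tel N : \sum_(t < N) rho t * (L (x t.+1) - fine (f0 w))
    <= \sum_(k < N) rho k * eps k
       + (norm2 (y 0%N - y') ^+ 2 - norm2 (y N - y') ^+ 2) / 2
       + (norm2 (z 0%N - z') ^+ 2 - norm2 (z N - z') ^+ 2) / 2.
  elim: N => [|N IH]; first by rewrite !big_ord0; lra.
  by rewrite !big_ord_recr /=; have := (step N).2; move: IH; rewrite /L; lra.
have := tel K; rewrite y0 z0 !add0r.
have N2 q (u : 'cV[R]_q) : norm2 (- u) ^+ 2 = norm2 u ^+ 2.
  by rewrite !norm2_sqr dotNl dotNr opprK.
rewrite !N2.
by have := sqr_ge0 (norm2 (y K - y')); have := sqr_ge0 (norm2 (z K - z')); lra.
Qed.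

(** * Choice of the dual pair and the two estimates *)

Lemma dot_pos_part (R : realType) (n : nat) (c : R) (u : 'cV[R]_n) :
  dot (c *: pos_part u) u = dot (c *: pos_part u) (pos_part u).
Proof.
apply: eq_bigr => i _; rewrite !mxE.
by case: leP => //; rewrite !mulr0 mul0r.
Qed.

Theorem theorem4 (R : realType) (n p m : nat) (X : set 'cV[R]_n)
    (A : 'M[R]_(p, n)) (b : 'cV[R]_p)
    (f0 : 'cV[R]_n -> \bar R) (f : 'I_m -> 'cV[R]_n -> R)
    (X_closed : closed X) (X_convex : convex_set X)
    (f0_proper : eproper f0) (f0_convex : econvex f0)
    (f_convex : forall i, convex_function setT (f i))
    (f_diff : forall i x, differentiable (f i) x)
    (beta rho eps : nat -> R)
    (beta_gt0 : forall k, 0 < beta k)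
    (rho_gt0 : forall k, 0 < rho k)
    (eps_ge0 : forall k, 0 <= eps k)
    (rho_le_beta : forall k, rho k <= beta k)
    (x : nat -> 'cV[R]_n) (y : nat -> 'cV[R]_p) (z : nat -> 'cV[R]_m)
    (alm : inexact_ALM X f0 A b f beta rho eps x y z)
    (y0 : y 0%N = 0) (z0 : z 0%N = 0)
    (xs : 'cV[R]_n) (ys : 'cV[R]_p) (zs : 'cV[R]_m)
    (kkt : KKT X f0 A b f xs ys zs)
    (K : nat) (K_ge1 : (1 <= K)%N) :
  let xbar := wavg rho x K in
  (`| f0 xbar - f0 xs |
     <= ((\sum_(t < K) rho t)^-1
         * (2 * norm2 ys ^+ 2 + 2 * norm2 zs ^+ 2
            + \sum_(k < K) rho k * eps k))%:E)%E /\
  norm2 (A *m xbar - b) + norm2 (pos_part (\col_i f i xbar))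
    <= (\sum_(t < K) rho t)^-1
       * ((1 + norm2 ys) ^+ 2 / 2 + (1 + norm2 zs) ^+ 2 / 2
          + \sum_(k < K) rho k * eps k).
Proof.
move=> xbar.
have f0xs : f0 xs \is a fin_num.
  by have [[g gsub] _] := KKT_stationary kkt; exact: subdiff_fin_num gsub.
have erg y' (z' : 'cV[R]_m) (z'0 : forall i, 0 <= z' i 0) :=
  ALM_ergodic y' X_convex f0_proper f0_convex f_convex rho_gt0 rho_le_beta alm
    y0 z0 (KKT_mem kkt) (KKT_eq kkt) (KKT_ineq kkt) f0xs z'0 K_ge1.
have [Xb fb _] := erg 0 zs (KKT_dual kkt).
have := KKT_saddle f_convex f_diff kkt Xb.
rewrite -/xbar -(fineK f0xs) -(fineK fb) -EFinB -EFinD !lee_fin => saddle.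
have S0 := sum_ord_gt0 rho_gt0 K_ge1.
set r := A *m xbar - b in saddle *.
set g := pos_part _.
set D := fine (f0 xbar) - fine (f0 xs).
set E := \sum_(k < K) rho k * eps k.
have gE (z' : 'cV[R]_m) : \sum_i z' i 0 * f i xbar = dot z' (\col_i f i xbar).
  by apply: eq_bigr => i _; rewrite mxE.
(* Multipliers of lengths at most c and c' along r and g turn the pairings into c |r| and c' |g|;
   the second uses that g vanishes wherever f_i is negative. *)
have bound c c' : 0 <= c -> 0 <= c' ->
    (\sum_(t < K) rho t) * (D + c * norm2 r + c' * norm2 g)
    <= E + c ^+ 2 / 2 + c' ^+ 2 / 2.
  move=> c0 c'0.
  have [yr yn] := norm2_dual r c0.
  have [zg zn] := norm2_dual g c'0.
  have z'0 i : 0 <= ((c' / norm2 g) *: g) i 0.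
    by rewrite !mxE mulr_ge0 ?divr_ge0 ?norm2_ge0 // le_max lexx orbT.
  have [_ _] := erg ((c / norm2 r) *: r) _ z'0.
  rewrite -/xbar gE dot_pos_part -/r -/D -/E -/g yr zg; move: yn zn; lra.
(* Cauchy-Schwarz applied to the saddle inequality, with f_i replaced by its positive part since zs
   >= 0. *)
have lowD : - (norm2 ys * norm2 r + norm2 zs * norm2 g) <= D.
  have := dot_le_norm2 ys r; have := dot_le_norm2 zs g.
  suff : \sum_i zs i 0 * f i xbar <= dot zs g by move: saddle; rewrite /D; lra.
  apply: ler_sum => i _; rewrite !mxE ler_wpM2l ?(KKT_dual kkt) //.
  by rewrite le_max lexx.
have ys0 := norm2_ge0 ys; have zs0 := norm2_ge0 zs.
split; last first.
  rewrite ler_pdivlMl //.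
  (* The parts |ys| and |zs| absorb the lower bound on D, so the extra 1 leaves exactly |r| +
     |g|. *)
  have := bound (1 + norm2 ys) (1 + norm2 zs).
  have := ler_wpM2l (ltW S0) lowD.
  rewrite !addr_ge0 //; move=> H /(_ isT isT); move: H; lra.
rewrite ler_norml; apply/andP; split.
  apply: (le_trans _ lowD); rewrite lerN2 ler_pdivlMl //.
  (* One copy of |ys| |r| + |zs| |g| offsets D and the other is the quantity to be bounded;
     (2|ys|)^2/2 gives the constant 2. *)
  have := bound (2 * norm2 ys) (2 * norm2 zs).
  have := ler_wpM2l (ltW S0) lowD.
  rewrite !mulr_ge0 //; move=> H /(_ isT isT); move: H; lra.
rewrite ler_pdivlMl //; have := bound 0 0 (lexx _) (lexx _).
by have := sqr_ge0 (norm2 ys); have := sqr_ge0 (norm2 zs); lra.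
Qed.
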